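(* Let $w:[0,1]^d\to\mathbb{R}$ be bounded, non-negative and integrable. Then the weighted Cramér–von Mises statistic $$W_n = n\int_{[0,1]^d}\Big(C_n(\mathbf{u})-\prod_{j=1}^d u_j\Big)^2 w(\mathbf{u})\,d\mathbf{u}$$ satisfies $$W_n=\sum_{i=1}^n\left[\frac1n\sum_{l=1}^n\mu_1(w)\big(\hat U_{i,1}\vee\hat U_{l,1},\dots,\hat U_{i,d}\vee\hat U_{l,d}\big)-2\,\mu_2(w)\big(\hat U_{i,1},\dots,\hat U_{i,d}\big)\right]+n\,\mu_3(w).$$
   Context: Let $d\ge2$ and let $(X_{i,1},\dots,X_{i,d})$, $i=1,\dots,n$, be a sample of $n$ observations in $\mathbb{R}^d$. With $\mathbb{I}$ the indicator function, set $\hat F_j(x)=\frac1n\sum_{i=1}^n\mathbb{I}(X_{i,j}\le x)$, $\hat U_{i,j}=\hat F_j(X_{i,j})$, and let the empirical copula be $$C_n(\mathbf{u})=\frac1n\sum_{i=1}^n\prod_{j=1}^d\mathbb{I}(\hat U_{i,j}\le u_j),\qquad\mathbf{u}\in[0,1]^d.$$ Write $a\vee b=\max(a,b)$. For $\mathbf{a}=(a_1,\dots,a_d)\in[0,1]^d$ define $$\mu_1(w)(\mathbf{a})=\int_{a_1}^1\cdots\int_{a_d}^1 w(u_1,\dots,u_d)\,du_1\cdots du_d,$$ $$\mu_2(w)(\mathbf{a})=\int_{a_1}^1\cdots\int_{a_d}^1 u_1u_2\cdots u_d\,w(u_1,\dots,u_d)\,du_1\cdots du_d,$$ $$\mu_3(w)=\int_0^1\cdots\int_0^1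 u_1^2u_2^2\cdots u_d^2\,w(u_1,\dots,u_d)\,du_1\cdots du_d.$$ *)

(* Defs.v *)
From HB Require Import structures.
From mathcomp Require Import all_boot all_order all_algebra.
From mathcomp Require Import all_classical all_reals all_analysis.

Set Implicit Arguments.
Unset Strict Implicit.
Unset Printing Implicit Defensive.
Import Order.TTheory GRing.Theory Num.Theory.
Import numFieldNormedType.Exports.
Local Open Scope classical_set_scope.
Local Open Scope ring_scope.

Section ConsMeasure.
Context {R : realType} (d : nat).
Variable m : {sigma_finite_measure set (d.-tuple (measurableTypeR R)) -> \bar R}.

Let RT := measurableTypeR R.

Definition pair_cons (p : RT * d.-tuple RT) : d.+1.-tuple RT :=
  [tuple of p.1 :: p.2].

Let measurable_pair_cons : measurable_fun [set: RT * d.-tuple RT] pair_cons.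
Proof. exact: measurable_cons. Qed.

Definition cons_measure : set (d.+1.-tuple RT) -> \bar R :=
  pushforward (@lebesgue_measure R \x m)%E pair_cons.

Let cons_measure0 : cons_measure set0 = 0%E.
Proof. by rewrite /cons_measure /pushforward preimage_set0 measure0. Qed.

Let cons_measure_ge0 A : (0 <= cons_measure A)%E.
Proof. exact: integral_ge0. Qed.

Let cons_measure_sigma_additive : semi_sigma_additive cons_measure.
Proof.
have mc := measurable_pair_cons.
move=> F mF tF mUF; rewrite /cons_measure /pushforward preimage_bigcup.
apply: measure_semi_sigma_additive.
- by move=> n; rewrite -[X in measurable X]setTI; exact: mc.
- apply/trivIsetP => /= i j _ _ ij; rewrite -preimage_setI.
  by move/trivIsetP : tF => /(_ _ _ _ _ ij) ->//; rewrite preimage_set0.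
- by rewrite -preimage_bigcup -[X in measurable X]setTI; exact: mc.
Qed.

HB.instance Definition _ := isMeasure.Build _ _ _ cons_measure
  cons_measure0 cons_measure_ge0 cons_measure_sigma_additive.

Let cons_measure_sigma_finite : sigma_finite setT cons_measure.
Proof.
have /sigma_finiteP[F [TF ndF Foo]] := sigma_finiteT (@lebesgue_measure R).
have /sigma_finiteP[G [TG ndG Goo]] := sigma_finiteT m.
pose uncons (t : d.+1.-tuple RT) : RT * d.-tuple RT :=
  (thead t, [tuple of behead t]).
have unconsK : cancel pair_cons uncons.
  by case=> x t; rewrite /uncons /=; congr pair; apply/val_inj.
have mu : measurable_fun setT uncons.
  by apply/measurable_fun_pair; [exact: measurable_tnth|exact: measurable_behead].
exists (fun n => uncons @^-1` (F n `*` G n)).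
  rewrite -preimage_bigcup [X in _ @^-1` X](_ : _ = setT) ?preimage_setT//.
  rewrite -setXTT TF TG predeqE => -[x y]; split.
    by move=> [n _ []/= ? ?]; split; exists n.
  move=> [/= [n _ Fnx] [k _ Gky]]; exists (maxn n k) => //; split.
  - by move: x Fnx; exact/subsetPset/ndF/leq_maxl.
  - by move: y Gky; exact/subsetPset/ndG/leq_maxr.
move=> k; have [? ?] := Foo k; have [? ?] := Goo k.
split; first by rewrite -[X in measurable X]setTI; apply: mu => //; exact: measurableX.
rewrite /cons_measure /pushforward -comp_preimage (_ : uncons \o pair_cons = id).
  by rewrite preimage_id product_measure1E// lte_mul_pinfty// ge0_fin_numE.
by apply/funext => p /=; rewrite unconsK.
Qed.

HB.instance Definition _ := Measure_isSigmaFinite.Build _ _ _ cons_measure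
  cons_measure_sigma_finite.

End ConsMeasure.

Section Lebesgue.
Context {R : realType}.

(* Lebesgue measure on the Borel sets of R^d, R^d being d.-tuple R, as the
   d-fold product of the one-dimensional one. *)
Fixpoint borel_lebesgue (d : nat) :
    {sigma_finite_measure set (d.-tuple (measurableTypeR R)) -> \bar R} :=
  match d with
  | 0 => \d_[tuple]
  | d'.+1 => cons_measure (borel_lebesgue d')
  end.

(* Its completion, defined on all Lebesgue-measurable subsets of R^d: with it,
   integrability does not require Borel measurability. *)
Definition lebesgue_tuple (d : nat) : set _ -> \bar R :=
  @completed_measure_extension _ _ _ (borel_lebesgue d).

HB.instance Definition _ (d : nat) := Measure.on (@lebesgue_tuple d).

Definition unit_cube (d : nat) : set (d.-tuple R) :=
  [set u | forall j, tnth u j \in `[0, 1]].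

(* iterated_int a f is the integral of f over u_1 from a_1 to 1 (outermost),
   ..., u_d from a_d to 1 (innermost). *)
Fixpoint iterated_int (d : nat) : d.-tuple R -> (d.-tuple R -> R) -> R :=
  match d with
  | 0 => fun _ f => f [tuple]
  | d'.+1 => fun a f =>
      \int[@completed_lebesgue_measure R]_(x in [set` `[thead a, 1]])
        iterated_int [tuple of behead a] (fun t => f [tuple of x :: t])
  end.

Definition mu1 (d : nat) (w : d.-tuple R -> R) (a : d.-tuple R) : R :=
  iterated_int a w.

Definition mu2 (d : nat) (w : d.-tuple R -> R) (a : d.-tuple R) : R :=
  iterated_int a (fun u => (\prod_(j < d) tnth u j) * w u).

Definition mu3 (d : nat) (w : d.-tuple R -> R) : R :=
  iterated_int [tuple 0 | _ < d] (fun u => (\prod_(j < d) tnth u j ^+ 2) * w u).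

Section Sample.
Context (n d : nat) (X : 'I_n -> 'I_d -> R).

Definition ecdf (j : 'I_d) (x : R) : R :=
  n%:R^-1 * \sum_(i < n) (X i j <= x)%R%:R.

Definition pseudo_obs (i : 'I_n) (j : 'I_d) : R := ecdf j (X i j).

Definition empirical_copula (u : d.-tuple R) : R :=
  n%:R^-1 * \sum_(i < n) \prod_(j < d) (pseudo_obs i j <= tnth u j)%R%:R.

Definition weighted_cvm (w : d.-tuple R -> R) : R :=
  n%:R * \int[@lebesgue_tuple d]_(u in @unit_cube d)
    ((empirical_copula u - \prod_(j < d) tnth u j) ^+ 2 * w u).

End Sample.
End Lebesgue.

Arguments borel_lebesgue R d : clear implicits.
Arguments lebesgue_tuple R d : clear implicits.
Arguments unit_cube R d : clear implicits.

(* Main.v *)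
Require Import Defs.
From mathcomp Require Import all_boot all_order all_algebra.
From mathcomp Require Import all_classical all_reals all_analysis.
From mathcomp Require Import measurable_realfun ring.
Import Order.TTheory GRing.Theory Num.Theory.
Import numFieldNormedType.Exports.
Local Open Scope classical_set_scope.
Local Open Scope ring_scope.

(** Expanding the square is the whole of the algebra. For u in the unit cube,
    the summand with index i in the empirical copula is the indicator of the
    box of points above the vector of pseudo-observations of i, and a product
    of two such indicators is the indicator of the box above the componentwise
    maximum. With P u the product of the coordinates of u, the integrand
    (C_n - P)^2 w is thus a linear combination of functions of the form
    (indicator of a box) * P^k * w with k = 0, 1, 2; their integrals over the
    cube are the values of mu1, mu2 and mu3 ([sqr_copula_dist_expand]).

    The analytic content is that the integral of such a function over a box,
    for the completed Lebesgue measure of R^d, is the iterated integral. Since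
    w is only Lebesgue measurable, its sections need not be measurable, and the
    value of an inner integral is arbitrary on a null set of outer variables.
    Therefore w is first replaced by a bounded nonnegative Borel function g that
    agrees with w on the cube outside a Borel null set N
    ([borel_representative]).
    This rests on the fact that a set of finite measure that is measurable for
    the completion is Borel up to a Borel null set, because outer measures are
    attained on measurable hulls ([caratheodory_measurable_mod_null]).

    By Tonelli's theorem almost all sections of N are null
    ([ae_null_section]). Hence, by induction on d, the iterated integral of w
    is the integral of g over the box ([iterated_intE]): at each stage the
    integrand of the outer integral agrees almost everywhere with a Borel
    function, so it is measurable for the completed one-dimensional measure,
    however the inner integral behaves on the exceptional set. On the other
    side, the integral of f w for the completion is the integral of f g for the
    Borel measure ([Rintegral_lebesgue_tuple]). Everything then takes place
    among bounded Borel functions on a set of measure 1, where integration is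
    linear. *)

Set Implicit Arguments.
Unset Strict Implicit.

(** * Completion of a measure *)

(** Used with [phi] the identity map from a set with a completed sigma-algebra
    to the same set with its Borel sigma-algebra: it is how an integral passes
    from one measurable structure to the other. *)
Lemma ge0_integral_measure_preserving d1 d2 (T1 : measurableType d1)
    (T2 : measurableType d2) (R : realType)
    (m1 : {measure set T1 -> \bar R}) (m2 : {measure set T2 -> \bar R})
    (phi : T1 -> T2) (D : set T2) (f : T2 -> \bar R) :
  measurable_fun setT phi ->
  (forall A, measurable A -> m1 (phi @^-1` A) = m2 A) ->
  measurable D -> measurable_fun D f -> (forall x, D x -> (0 <= f x)%E) ->
  (\int[m1]_(x in phi @^-1` D) f (phi x) = \int[m2]_(x in D) f x)%E.
Proof.
move=> mphi m12 mD mf f0.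
transitivity (\int[pushforward m1 phi]_(x in D) f x)%E.
  by rewrite ge0_integral_pushforward// => y /set_mem; exact: f0.
by apply: eq_measure_integral => // A mA _; exact: m12.
Qed.

Section Completion.
Context d (T : measurableType d) (R : realType) (mu : {measure set T -> \bar R}).
Local Notation cT := (caratheodory_type (mu^*)%mu).
Local Notation cmu := (@completed_measure_extension _ _ _ mu).

(** If the outer measure is finite, the hull is the intersection over n of the
    unions of countable measurable covers of [A] whose total measure is within
    1 / (n + 1) of the infimum that defines the outer measure; otherwise the
    whole space will do. *)
Lemma measurable_hull (A : set T) :
  exists H, [/\ measurable H, A `<=` H & mu H = (mu^*)%mu A].
Proof.
have leH H : measurable H -> A `<=` H -> ((mu^*)%mu A <= mu H)%E.
  by move=> mH AH; rewrite -(measurable_mu_extE mu mH); exact: le_mu_ext.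
have [Aoo|] := eqVneq ((mu^*)%mu A) +oo%E.
  exists setT; split => //; apply/eqP.
  by rewrite Aoo -leye_eq -[leLHS]Aoo leH.
rewrite -ltey => Afin.
have Afn : (mu^*)%mu A \is a fin_num by rewrite ge0_fin_numE// mu_ext_ge0.
have /choice[H HP] (n : nat) : exists H, [/\ measurable H, A `<=` H &
    (mu H <= (mu^*)%mu A + n.+1%:R^-1%:E)%E].
  have n0 : 0 < n.+1%:R^-1 :> R by rewrite invr_gt0.
  have [_ [F [mF AF] <-] Flt] := lb_ereal_inf_adherent n0 Afn.
  exists (\bigcup_k F k); split => //; first exact: bigcupT_measurable.
  apply: le_trans (ltW Flt); apply: measure_sigma_subadditive => //.
  exact: bigcupT_measurable.
have mH : measurable (\bigcap_n H n).
  by apply: bigcapT_measurable => n; have [] := HP n.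
have AH : A `<=` \bigcap_n H n.
  by move=> t At n _; have [_ AHn _] := HP n; exact: AHn.
exists (\bigcap_n H n); split => //.
apply/eqP; rewrite eq_le leH// andbT.
apply/lee_addgt0Pr => _/posnumP[e]; near \oo => n.
apply: (@le_trans _ _ (mu (H n))).
  have [mHn _ _] := HP n.
  by apply: le_measure; rewrite ?inE//; exact: bigcap_inf.
have [_ _ /le_trans] := HP n; apply.
rewrite leeD2l// lee_fin ltW//.
by near: n; apply: near_infty_natSinv_lt.
Unshelve. all: by end_near. Qed.

(** A hull [B] of [E] exceeds it by a set of outer measure zero: split [B] by
    the Caratheodory condition for [E] and cancel the finite outer measure of
    [E]. A hull of that excess is the null set [N]. *)
Lemma caratheodory_measurable_mod_null (E : set T) :
  (mu^*)%mu.-cara.-measurable E -> ((mu^*)%mu E < +oo)%E ->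
  exists B N, [/\ measurable B, measurable N, mu N = 0%E &
    E `\` N = B `\` N].
Proof.
move=> mE Efin.
have [B [mB EB muB]] := measurable_hull E.
have [N [mN BEN muN]] := measurable_hull (B `\` E).
exists B, N; split => //; last first.
  apply/seteqP; split => [t [/EB]//|t [Bt Nt]]; split => //.
  by apply: contrapT => Et; apply: Nt; exact: BEN.
have : ((mu^*)%mu B = (mu^*)%mu (B `&` E) + (mu^*)%mu (B `\` E))%E := mE B.
rewrite setIidr// (measurable_mu_extE mu mB) muB -muN.
have Efn : (mu^*)%mu E \is a fin_num by rewrite ge0_fin_numE// mu_ext_ge0.
by move=> EN; rewrite -[LHS](addeK _ Efn) [X in (X - _)%E]addeC -EN subee.
Qed.

Lemma measurable_id_completion :
  measurable_fun (setT : set cT) (id : cT -> T).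
Proof.
by move=> _ B mB; rewrite setTI; exact: caratheodory_measurable_mu_ext.
Qed.

(** Countably many level sets decide measurability, so the null sets attached to
    the levels above each rational number have a null union [N]; off [N] each
    level set of [f] is measurable for the original sigma-algebra. *)
Lemma measurable_fun_mod_null (D : set T) (f : T -> R) :
  measurable D -> (mu D < +oo)%E ->
  measurable_fun (D : set cT) (f : cT -> R) ->
  exists N, [/\ measurable N, mu N = 0%E & measurable_fun (D `\` N) f].
Proof.
move=> mD Dfin mf.
have mD' : measurable (D : set cT) by exact: caratheodory_measurable_mu_ext.
(* an enumeration of the rationals, with 0 at the indices that code none *)
pose q (n : nat) : R := ratr (odflt 0 (unpickle n : option rat)).
have /choice[BN BNP] (n : nat) : exists BN : set T * set T,
    [/\ measurable BN.1, measurable BN.2, mu BN.2 = 0%E &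
      (D `&` f @^-1` `]q n, +oo[) `\` BN.2 = BN.1 `\` BN.2].
  have mE : measurable (D `&` f @^-1` `]q n, +oo[ : set cT) by exact: mf.
  have Efin : ((mu^*)%mu (D `&` f @^-1` `]q n, +oo[) < +oo)%E.
    apply: le_lt_trans Dfin; rewrite -(measurable_mu_extE mu mD).
    by apply: le_mu_ext; exact: subIsetl.
  have [B [N BNP]] := caratheodory_measurable_mod_null mE Efin.
  by exists (B, N).
set N := \bigcup_n (BN n).2.
have mN : measurable N by apply: bigcupT_measurable => n; have [] := BNP n.
have N0 n t : ~ N t -> ~ (BN n).2 t by move=> Nt BNt; apply: Nt; exists n.
exists N; split => //.
  apply/negligibleP => //; apply: negligible_bigcup => n.
  by have [_ mNn Nn0 _] := BNP n; exact/negligibleP.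
move=> mDN; apply: (measurability _ (RGenOInfty.measurableE R)) => //.
move=> _ [_ [x ->] <-].
rewrite [X in measurable X](_ : _ =
    (\bigcup_(n in [set n | x < q n]) (BN n).1) `\` N).
  apply: measurableD => //; apply: bigcup_measurable => n _.
  by have [] := BNP n.
apply/seteqP; split => t /=; rewrite ?in_itv/= ?andbT.
- move=> [[Dt Nt] xft]; split => //.
  have [r] := rat_in_itvoo xft; rewrite inE/= => /andP[xr rf].
  have qr : q (pickle r) = ratr r by rewrite /q pickleK.
  exists (pickle r); rewrite /= ?qr//; have [_ _ _] := BNP (pickle r).
  move=> /seteqP[/(_ t) + _] => /(_ _)[]//; split; last exact: N0.
  by split => //=; rewrite in_itv/= andbT qr.
- move=> [[n /= xq Bt] Nt]; have [_ _ _] := BNP n.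
  move=> /seteqP[_ /(_ t)] => /(_ _)[]; first by split => //; exact: N0.
  by rewrite /= in_itv/= andbT => -[Dt qf] _; split => //; exact: lt_trans qf.
Qed.

Lemma ge0_integral_completion (D : set T) (f : T -> \bar R) :
  measurable D -> measurable_fun D f -> (forall x, D x -> (0 <= f x)%E) ->
  (\int[cmu]_(x in D) f x = \int[mu]_(x in D) f x)%E.
Proof.
apply: (@ge0_integral_measure_preserving _ _ cT T R cmu mu id D f
  measurable_id_completion).
exact: measurable_mu_extE.
Qed.

Lemma ge0_integral_completion_ae (D N : set T) (f g : T -> \bar R) :
  measurable D -> measurable N -> mu N = 0%E ->
  measurable_fun (D : set cT) (f : cT -> \bar R) -> measurable_fun D g ->
  (forall x, D x -> (0 <= g x)%E) ->
  (forall x, D x -> ~ N x -> f x = g x) ->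
  (\int[cmu]_(x in D) f x = \int[mu]_(x in D) g x)%E.
Proof.
move=> mD mN N0 mf mg g0 fg; rewrite -ge0_integral_completion//.
apply: ae_eq_integral => //.
- exact: caratheodory_measurable_mu_ext.
- move=> mD' B mB; apply: caratheodory_measurable_mu_ext; exact: mg.
- exists N; split; first exact: caratheodory_measurable_mu_ext.
    exact: etrans (measurable_mu_extE mu mN) N0.
  move=> x /= /not_implyP[Dx]; apply: contra_notP; exact: fg.
Qed.

End Completion.

(** * Finite sums of real-valued integrals *)

Section RintegralSum.
Context d (T : measurableType d) (R : realType) (mu : {measure set T -> \bar R}).

Lemma Rintegral_sum (D : set T) (I : Type) (s : seq I) (h : I -> T -> R) :
  measurable D -> (forall i, mu.-integrable D (EFin \o h i)) ->
  \int[mu]_(x in D) (\sum_(i <- s) h i x) =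
  \sum_(i <- s) \int[mu]_(x in D) h i x.
Proof.
move=> mD ih; rewrite /Rintegral.
under eq_integral do rewrite -sumEFin.
rewrite integral_sum// -sum_fine// => i _.
exact: integrable_fin_num (ih i).
Qed.

Lemma integrable_Rsum (D : set T) (I : Type) (s : seq I) (h : I -> T -> R) :
  measurable D -> (forall i, mu.-integrable D (EFin \o h i)) ->
  mu.-integrable D (EFin \o (fun x => \sum_(i <- s) h i x)).
Proof.
move=> mD ih.
rewrite (_ : EFin \o _ = (fun x => \sum_(i <- s) (EFin \o h i) x)%E); last first.
  by apply/funext => x /=; rewrite sumEFin.
exact: integrable_sum.
Qed.

End RintegralSum.

(** * Borel Lebesgue measure and iterated integrals *)

Section BorelLebesgue.
Context (R : realType).
Local Notation RT := (measurableTypeR R).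
Local Notation mu d := (borel_lebesgue R d).
Local Notation lambda := (@lebesgue_measure R).

(** The domain of integration of [iterated_int a]. *)
Definition upper_box d (a : d.-tuple R) : set (d.-tuple R) :=
  [set u | forall j, tnth u j \in `[tnth a j, 1]].

Lemma measurable_upper_box d (a : d.-tuple R) :
  measurable (upper_box a : set (d.-tuple RT)).
Proof.
rewrite (_ : upper_box a = \bigcap_(j : 'I_d)
    ((tnth (T:=RT))^~ j @^-1` [set` `[tnth a j, 1]])); last first.
  by apply/seteqP; split => [u au j _|u au j]; [exact: au|exact: (au j I)].
apply: fin_bigcap_measurable => // j _.
by rewrite -[X in measurable X]setTI; exact: measurable_tnth.
Qed.

Lemma upper_box0 d : upper_box [tuple 0 | _ < d] = unit_cube R d.
Proof.
by apply/seteqP; split => u uj j; have := uj j; rewrite tnth_mktuple.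
Qed.

Lemma measurable_unit_cube d : measurable (unit_cube R d : set (d.-tuple RT)).
Proof. by rewrite -upper_box0; exact: measurable_upper_box. Qed.

Lemma upper_box_cons d (a : d.+1.-tuple R) x (t : d.-tuple R) :
  upper_box a [tuple of x :: t] <->
  x \in `[thead a, 1] /\ upper_box [tuple of behead a] t.
Proof.
split=> [ax|[ax at_] j].
  split => [|j]; first exact: (ax ord0).
  have := ax (lift ord0 j).
  by rewrite tnthS !(tnth_nth 0)/= nth_behead.
case: (unliftP ord0 j) => [i ->|->]; last by rewrite /thead in ax.
have := at_ i.
by rewrite tnthS !(tnth_nth 0)/= nth_behead.
Qed.

(** Tonelli's theorem with the first coordinate outermost, the order in which
    [iterated_int] integrates. *)
Lemma ge0_integral_borel_lebesgueS d (f : d.+1.-tuple R -> \bar R) :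
  measurable_fun (setT : set (d.+1.-tuple RT)) f -> (forall u, (0 <= f u)%E) ->
  (\int[mu d.+1]_u f u =
   \int[lambda]_x \int[mu d]_t f [tuple of x :: t])%E.
Proof.
move=> mf f0.
have mc : measurable_fun setT (@pair_cons R d) by exact: measurable_cons.
rewrite [LHS](ge0_integral_pushforward mc)//= preimage_setT.
rewrite fubini_tonelli1//.
exact: measurableT_comp mf mc.
Qed.

Lemma measurable_section_integral d (f : d.+1.-tuple R -> \bar R) :
  measurable_fun (setT : set (d.+1.-tuple RT)) f -> (forall u, (0 <= f u)%E) ->
  measurable_fun (setT : set RT) (fun x => \int[mu d]_t f [tuple of x :: t])%E.
Proof.
move=> mf f0.
have mc : measurable_fun setT (@pair_cons R d) by exact: measurable_cons.
have mfc : measurable_fun setT (f \o @pair_cons R d).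
  exact: measurableT_comp mf mc.
exact: (measurable_fun_fubini_tonelli_F (m2 := mu d) _ mfc (fun u => f0 _)).
Qed.

(** The measure of the section at [x] is, by Tonelli, a nonnegative function of
    [x] with integral zero. *)
Lemma ae_null_section d (N : set (d.+1.-tuple R)) :
  measurable (N : set (d.+1.-tuple RT)) -> mu d.+1 N = 0%E ->
  {ae lambda, forall x, mu d [set t : d.-tuple R | N [tuple of x :: t]] = 0%E}.
Proof.
move=> mN N0.
have mf : measurable_fun (setT : set (d.+1.-tuple RT))
    (EFin \o \1_N : _ -> \bar R).
  exact/measurable_EFinP.
have f0 u : (0 <= (EFin \o \1_N) u :> \bar R)%E by rewrite lee_fin.
have := ge0_integral_borel_lebesgueS mf f0.
rewrite [LHS]integral_indic// setIT => NE.
have intN0 := etrans (esym NE) N0.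
have := measurable_section_integral mf f0.
set F := fun x => _ in intN0 * => mF.
have F0 x : (0 <= F x)%E by apply: integral_ge0.
have : ae_eq lambda setT F (cst 0%E).
  apply/ae_eq_integral_abs => //.
  by rewrite -[RHS]intN0; apply: eq_integral => x _; rewrite gee0_abs.
apply: filterS => x /(_ I) /= Fx0; rewrite -[RHS]Fx0 /F.
rewrite -[X in mu d X]setIT -integral_indic//.
rewrite -[X in measurable X]setTI.
have mx : measurable_fun setT
    (fun t : d.-tuple RT => [the d.+1.-tuple RT of x :: t]).
  exact: measurable_cons.
exact: mx.
Qed.

Lemma borel_lebesgue_unit_cube d : mu d (unit_cube R d) = 1%E.
Proof.
elim: d => [|d IH]; first by rewrite /= diracE mem_set// => -[].
rewrite /= /cons_measure /pushforward.
rewrite (_ : _ @^-1` _ = [set` `[0%R, 1%R]] `*` unit_cube R d).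
  rewrite product_measure1E//= ?IH ?mule1.
    by rewrite lebesgue_measure_itv/= lte_fin ltr01 oppr0 adde0.
  exact: measurable_unit_cube.
apply/seteqP; split => [[x t]/= ux|[x t]/= [x01 ut] j].
  split; first exact: (ux ord0).
  by move=> j; have := ux (lift ord0 j); rewrite tnthS.
by case: (unliftP ord0 j) => [i ->|->]//; rewrite tnthS.
Qed.

Lemma upper_box_unit_cube d (a : d.-tuple R) :
  (forall j, 0 <= tnth a j) -> upper_box a `<=` unit_cube R d.
Proof.
move=> a0 u au j; have := au j; rewrite !in_itv/= => /andP[au1 ->].
by rewrite (le_trans (a0 j)).
Qed.

Lemma ge0_integral_completed_lebesgue (D : set R) (f : R -> \bar R) :
  measurable (D : set RT) -> measurable_fun (D : set RT) f ->
  (forall x, D x -> (0 <= f x)%E) ->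
  (\int[@completed_lebesgue_measure R]_(x in D) f x =
   \int[lambda]_(x in D) f x)%E.
Proof.
apply: (@ge0_integral_measure_preserving _ _ _ RT R
  (@completed_lebesgue_measure R) lambda id D f) => [_ B mB|A _].
  by rewrite setTI; exact: sub_caratheodory.
by [].
Qed.

Lemma ae_completed_lebesgue (P : set R) :
  {ae lambda, forall x, P x} -> {ae @completed_lebesgue_measure R, forall x, P x}.
Proof. by case=> A [mA A0 PA]; exists A; split => //; exact: sub_caratheodory. Qed.

(** The induction needs [f] and [g] apart: [f] is the function at hand, with no
    measurability, and [g] is a Borel function equal to it off [N]. For almost
    every [x] the section of [N] at [x] is null, so the inductive hypothesis
    applies to the sections of [f] and [g] and identifies the inner iterated
    integral with a Borel function [K] of [x]. For the other [x] the inner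
    integral is an arbitrary real number, which completeness of the measure in
    the outer integral makes harmless. The bound [M] keeps the integrals finite,
    so that no information is lost when they are turned into real numbers. *)
Lemma iterated_intE d (a : d.-tuple R) (f g : d.-tuple R -> R)
    (N : set (d.-tuple R)) (M : R) :
  (forall j, 0 <= tnth a j) ->
  measurable (N : set (d.-tuple RT)) -> mu d N = 0%E ->
  measurable_fun (setT : set (d.-tuple RT)) g ->
  (forall u, 0 <= g u <= M) ->
  (forall u, upper_box a u -> ~ N u -> f u = g u) ->
  ((iterated_int a f)%:E = \int[mu d]_(u in upper_box a) (g u)%:E)%E.
Proof.
elim: d a f g N => [|d IH] a f g N a0 mN N0 mg g0M fg.
  have a1 : upper_box a [tuple] by case.
  rewrite (_ : upper_box a = setT); last first.
    by apply/seteqP; split => // u _ [].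
  rewrite /= integral_dirac//; last exact/measurable_EFinP.
  rewrite diracE mem_set// mul1e fg// => N1.
  by move: N0; rewrite /= diracE mem_set// => /eqP; rewrite onee_eq0.
(* [K x] is the inner integral of [g] over the section of the box at [x]; it is
   0 when [x] is outside [I], where that section is empty *)
pose I : set R := [set` `[thead a, 1]].
have mI : measurable (I : set RT) by exact: measurable_itv.
pose b := [tuple of behead a].
pose G := (EFin \o g) \_ (upper_box a).
pose K x := (\int[mu d]_t G [tuple of x :: t])%E.
have g0 u : 0 <= g u by have /andP[] := g0M u.
have mG : measurable_fun (setT : set (d.+1.-tuple RT)) G.
  apply/(measurable_restrictT _ _).1; first exact: measurable_upper_box.
  by apply: measurable_funTS; exact/measurable_EFinP.
have G0 u : (0 <= G u)%E.
  by rewrite /G patchE; case: ifPn => //= _; rewrite lee_fin.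
have K0 x : (0 <= K x)%E by apply: integral_ge0.
have mK : measurable_fun (setT : set RT) K by exact: measurable_section_integral.
have KI x : I x ->
    K x = (\int[mu d]_(t in upper_box b) (g [tuple of x :: t])%:E)%E.
  move=> Ix; rewrite [RHS]integral_mkcond; apply: eq_integral => t _.
  rewrite /G !patchE /=; congr (if _ then _ else _).
  by apply/idP/idP => /set_mem bt; apply/mem_set;
    [have [] := (upper_box_cons _ _ _).1 bt|apply/upper_box_cons].
have KnI x : ~ I x -> K x = 0%E.
  move=> nIx; apply: integral0_eq => t _.
  by rewrite /G patchE memNset// => /upper_box_cons[].
have intG : (\int[mu d.+1]_(u in upper_box a) (g u)%:E
    = \int[lambda]_(x in I) K x)%E.
  rewrite [LHS]integral_mkcond [RHS]integral_mkcond.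
  rewrite [LHS](ge0_integral_borel_lebesgueS mG G0).
  apply: eq_integral => x _; rewrite patchE; case: ifPn => // /negP xI.
  by apply: KnI => Ix; apply: xI; exact/mem_set.
(* at most [M] times the measure of the cube, which is 1 *)
have intfin : (\int[mu d.+1]_(u in upper_box a) (g u)%:E)%E \is a fin_num.
  have mB : measurable (upper_box a : set (d.+1.-tuple RT)).
    exact: measurable_upper_box.
  rewrite ge0_fin_numE; last by apply: integral_ge0 => u _; rewrite lee_fin.
  apply: (@le_lt_trans _ _ (\int[mu d.+1]_(u in upper_box a) M%:E)%E).
    apply: ge0_le_integral => //.
    - by move=> u _; rewrite lee_fin.
    - by apply: measurable_funTS; exact/measurable_EFinP.
    - by move=> u _; rewrite lee_fin; have /andP[] := g0M u.
  rewrite integral_cst// ltey_eq; apply/orP; left.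
  rewrite fin_numM// ge0_fin_numE//.
  apply: le_lt_trans (ltry 1); rewrite -(borel_lebesgue_unit_cube d.+1).
  apply: le_measure; rewrite ?inE//; last exact: upper_box_unit_cube.
  exact: measurable_unit_cube.
have aeK : ae_eq (@completed_lebesgue_measure R) I
    (fun x => (iterated_int b (fun t => f [tuple of x :: t]))%:E) K.
  have [A [mA A0 NA]] := ae_completed_lebesgue (ae_null_section mN N0).
  exists A; split => //; apply: subset_trans NA => x /=.
  apply: contra_not => Nx0 Ix; rewrite KI//.
  have mx : measurable_fun (setT : set (d.-tuple RT))
      (fun t => [the d.+1.-tuple RT of x :: t]) by exact: measurable_cons.
  apply: (IH _ _ (fun t => g [tuple of x :: t])
      [set t : d.-tuple R | N [tuple of x :: t]]) => //.
  - by move=> j; rewrite tnth_behead.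
  - by rewrite -[X in measurable X]setTI; exact: mx.
  - exact: measurableT_comp mg mx.
  - by move=> t bt Nt; apply: fg => //; apply/upper_box_cons.
rewrite /= /Rintegral.
have mKI : measurable_fun (I : set RT) K by exact: measurable_funTS.
rewrite (_ : (\int[_]_(x in _) _)%E = \int[lambda]_(x in I) K x)%E.
  by rewrite -intG fineK.
rewrite -ge0_integral_completed_lebesgue//.
have mIc : measurable (I : set (caratheodory_type (wlength idfun)^*%mu)).
  by apply: sub_caratheodory; exact: mI.
have mKc : measurable_fun (I : set (caratheodory_type (wlength idfun)^*%mu)) K.
  by move=> _ B mB; apply: sub_caratheodory; exact: mKI.
apply: (@ae_eq_integral _ _ _ completed_lebesgue_measure _ _ _ mIc _ mKc aeK).
apply: (ae_measurable_fun completed_lebesgue_measure_is_complete _ mKc).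
have [A [mA A0 NA]] := aeK.
exists A; split => //; apply: subset_trans NA => x /=.
by apply: contra_not => aKx Ix; rewrite aKx.
Qed.

Lemma integrable_unit_cube d (h : d.-tuple R -> R) (M : R) :
  measurable_fun (unit_cube R d : set (d.-tuple RT)) h ->
  (forall u, unit_cube R d u -> 0 <= h u <= M) ->
  (mu d).-integrable (unit_cube R d) (EFin \o h).
Proof.
move=> mh h0M; apply: measurable_bounded_integrable => //.
- exact: measurable_unit_cube.
- by rewrite [X in (X < _)%E]borel_lebesgue_unit_cube ltry.
- exists M; split; first exact: num_real.
  move=> y My u ucube; have /andP[h0 hM] := h0M u ucube.
  by rewrite /= ger0_norm// (le_trans hM)// ltW.
Qed.

Lemma iterated_int_Rintegral d (a : d.-tuple R) (f g : d.-tuple R -> R)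
    (N : set (d.-tuple R)) (M : R) :
  (forall j, 0 <= tnth a j) ->
  measurable (N : set (d.-tuple RT)) -> mu d N = 0%E ->
  measurable_fun (setT : set (d.-tuple RT)) g ->
  (forall u, 0 <= g u <= M) ->
  (forall u, unit_cube R d u -> ~ N u -> f u = g u) ->
  iterated_int a f = \int[mu d]_(u in unit_cube R d) (\1_(upper_box a) u * g u).
Proof.
move=> a0 mN N0 mg g0M fg.
rewrite -[LHS]/(fine (iterated_int a f)%:E).
rewrite (iterated_intE (g := g) (N := N) (M := M))//; last first.
  by move=> u au; apply: fg; exact: upper_box_unit_cube au.
rewrite -[LHS]/(\int[mu d]_(u in upper_box a) g u).
rewrite -[X in Rintegral _ X _](setIidr (upper_box_unit_cube a0)).
rewrite Rintegral_mkcondr patch_indic; apply: eq_Rintegral => u _ /=.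
exact: mulrC.
Qed.

Lemma prod_leq_indic d (a u : d.-tuple R) : unit_cube R d u ->
  \prod_(j < d) (tnth a j <= tnth u j)%R%:R = \1_(upper_box a) u :> R.
Proof.
move=> u01; rewrite indicE.
have [au|nau] := boolP [forall j, tnth a j <= tnth u j].
  rewrite mem_set; first by rewrite big1// => j _; rewrite (forallP au).
  move=> j; rewrite in_itv/= (forallP au)/=.
  by have := u01 j; rewrite in_itv/= => /andP[].
rewrite memNset; last first.
  move=> au; case/negP: nau; apply/forallP => j.
  by have := au j; rewrite in_itv/= => /andP[].
case/forallPn : nau => j /negbTE auj.
by rewrite (bigD1 j)//= auj mul0r.
Qed.

Lemma indic_upper_boxM d (a b u : d.-tuple R) :
  \1_(upper_box a) u * \1_(upper_box b) u =
  \1_(upper_box [tuple Num.max (tnth a j) (tnth b j) | j < d]) u :> R.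
Proof.
rewrite !indicE -natrM mulnb -in_setI; congr (nat_of_bool _)%:R.
apply: asbool_equiv_eq.
split=> [[au bu] j|abu].
  have := au j; have := bu j; rewrite tnth_mktuple !in_itv/= ge_max.
  by move=> /andP[bu' u1] /andP[au' _]; apply/andP; split => //; apply/andP.
by split=> j; have := abu j;
  rewrite tnth_mktuple !in_itv/= ge_max => /andP[/andP[? ?] ?]; apply/andP.
Qed.

End BorelLebesgue.

Arguments measurable_unit_cube R d : clear implicits.

(** * A Borel representative of the weight *)

Section Representative.
Context (R : realType) (d : nat).
Local Notation RT := (measurableTypeR R).
Local Notation mu := (borel_lebesgue R d).
Local Notation cube := (unit_cube R d).

(** Cutting [w] off to 0 on a null set and outside the cube makes it Borel,
    nonnegative and bounded on the whole space, as [iterated_intE] requires. *)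
Lemma borel_representative (w : d.-tuple R -> R) :
  [bounded w u : R^o | u in cube] -> (forall u, cube u -> 0 <= w u) ->
  (lebesgue_tuple R d).-integrable cube (EFin \o w) ->
  exists (g : d.-tuple R -> R) (N : set (d.-tuple R)) (M : R),
    [/\ measurable (N : set (d.-tuple RT)), mu N = 0%E,
     measurable_fun (setT : set (d.-tuple RT)) g,
     (forall u, 0 <= g u <= M) & (forall u, cube u -> ~ N u -> w u = g u)].
Proof.
move=> [M [_ wM]] w0 /measurable_int/measurable_EFinP mw.
have cube_fin : (mu cube < +oo)%E.
  by rewrite [X in (X < _)%E]borel_lebesgue_unit_cube ltry.
have [N [mN N0 mwN]] :=
  measurable_fun_mod_null (measurable_unit_cube R d) cube_fin mw.
have M0 : 0 <= `|M| + 1 by rewrite addr_ge0.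
exists (w \_ (cube `\` N)), N, (`|M| + 1); split => //.
- apply/(measurable_restrictT _ _).1 => //.
  by apply: measurableD => //; exact: measurable_unit_cube.
- move=> u; rewrite patchE; case: ifPn => [/set_mem[cu _]|_].
    rewrite w0//= (le_trans (ler_norm _))//; apply: wM => //.
    by rewrite ltr_pwDr// ler_norm.
  by rewrite lexx.
- by move=> u cu Nu; rewrite patchE mem_set.
Qed.

(** The products [f w] and [f g] agree off [N]. The factor [f] is kept apart
    because it is Borel, while only [w] needs the completed sigma-algebra; it
    will be the squared distance between the empirical copula and the product
    of the coordinates. *)
Lemma Rintegral_lebesgue_tuple (f : d.-tuple R -> R) (w g : d.-tuple R -> R)
    (N : set (d.-tuple R)) :
  (lebesgue_tuple R d).-integrable cube (EFin \o w) ->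
  measurable (N : set (d.-tuple RT)) -> mu N = 0%E ->
  measurable_fun (cube : set (d.-tuple RT)) f ->
  measurable_fun (setT : set (d.-tuple RT)) g ->
  (forall u, 0 <= f u) -> (forall u, 0 <= g u) ->
  (forall u, cube u -> ~ N u -> w u = g u) ->
  \int[lebesgue_tuple R d]_(u in cube) (f u * w u) =
  \int[mu]_(u in cube) (f u * g u).
Proof.
move=> /measurable_int/measurable_EFinP mw mN N0 mf mg f0 g0 wg.
have mc := measurable_unit_cube R d.
congr fine; apply: (@ge0_integral_completion_ae _ _ _ mu cube N _ _ mc mN N0).
- apply/measurable_EFinP; apply: measurable_funM => //.
  by move=> _ B mB; apply: caratheodory_measurable_mu_ext; exact: mf.
- apply/measurable_EFinP; apply: measurable_funM => //.
  exact: measurable_funTS.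
- by move=> u _; rewrite lee_fin mulr_ge0.
- by move=> u cu Nu; rewrite wg.
Qed.

End Representative.

(** * Moments over boxes *)

Section BoxMoments.
Context (R : realType) (d : nat).
Local Notation RT := (measurableTypeR R).
Local Notation mu := (borel_lebesgue R d).
Local Notation cube := (unit_cube R d).

Definition prod_coord (u : d.-tuple R) : R := \prod_(j < d) tnth u j.

(** All the integrals in the expansion of the statistic have this integrand. *)
Definition box_moment (g : d.-tuple R -> R) (k : nat) (a u : d.-tuple R) : R :=
  \1_(upper_box a) u * (prod_coord u ^+ k * g u).

Lemma measurable_prod_coord : measurable_fun (setT : set (d.-tuple RT)) prod_coord.
Proof. by apply: measurable_prod => j _; exact: measurable_tnth. Qed.

Lemma prod_coord_ge0_le1 u : cube u -> 0 <= prod_coord u <= 1.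
Proof.
move=> u01; have u01' j : 0 <= tnth u j <= 1 by have := u01 j; rewrite in_itv.
rewrite /prod_coord prodr_ge0/=; last by move=> j _; have /andP[] := u01' j.
by rewrite prodr_ile1// => j _.
Qed.

Section Moments.
Variables (w g : d.-tuple R -> R) (N : set (d.-tuple R)) (M : R).
Hypotheses (mN : measurable (N : set (d.-tuple RT))) (N0 : mu N = 0%E).
Hypothesis mg : measurable_fun (setT : set (d.-tuple RT)) g.
Hypothesis g0M : forall u, 0 <= g u <= M.
Hypothesis wg : forall u, cube u -> ~ N u -> w u = g u.

Lemma prod_coordXM_bound k u : cube u -> 0 <= prod_coord u ^+ k * g u <= M.
Proof.
move=> cu; have /andP[P0 P1] := prod_coord_ge0_le1 cu.
have /andP[g0 gM] := g0M u.
rewrite mulr_ge0 ?exprn_ge0//= (le_trans _ gM)//.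
by rewrite ler_piMl// exprn_ile1.
Qed.

Lemma measurable_prod_coordXM k :
  measurable_fun (setT : set (d.-tuple RT)) (fun u => prod_coord u ^+ k * g u).
Proof.
by apply: measurable_funM => //; apply: measurable_funX;
  exact: measurable_prod_coord.
Qed.

Lemma integrable_box_moment k a :
  mu.-integrable cube (EFin \o box_moment g k a).
Proof.
apply: (@integrable_unit_cube _ _ _ M).
  apply: measurable_funTS; apply: measurable_funM.
    by apply: measurable_indic; exact: measurable_upper_box.
  exact: measurable_prod_coordXM.
move=> u cu; have /andP[Pk0 PkM] := prod_coordXM_bound k cu.
rewrite mulr_ge0//= (le_trans _ PkM)// ler_piMl//.
Qed.

(** The Borel function to which the iterated integral is compared has to be
    bounded on the whole space, while powers of the product of the coordinates
    are not: hence the cut-off outside the cube. *)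
Lemma iterated_int_box_moment k a : (forall j, 0 <= tnth a j) ->
  iterated_int a (fun u => prod_coord u ^+ k * w u) =
  \int[mu]_(u in cube) box_moment g k a u.
Proof.
move=> a0; pose gk := (fun u => prod_coord u ^+ k * g u) \_ cube.
have mgk : measurable_fun (setT : set (d.-tuple RT)) gk.
  apply/(measurable_restrictT _ _).1; first exact: measurable_unit_cube.
  by apply: measurable_funTS; exact: measurable_prod_coordXM.
have M0 : 0 <= M by have /andP[] := g0M a; exact: le_trans.
rewrite (@iterated_int_Rintegral _ _ _ _ gk N M)//.
- by apply: eq_Rintegral => u cu; rewrite /gk patchE cu.
- move=> u; rewrite /gk patchE; case: ifPn => [/set_mem|_].
    exact: prod_coordXM_bound.
  by rewrite lexx.
- by move=> u cu Nu; rewrite /gk patchE mem_set// wg.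
Qed.

Lemma mu1_box_moment a : (forall j, 0 <= tnth a j) ->
  mu1 w a = \int[mu]_(u in cube) box_moment g 0 a u.
Proof.
move=> a0; rewrite -iterated_int_box_moment//; congr iterated_int.
by apply/funext => u; rewrite expr0 mul1r.
Qed.

Lemma mu2_box_moment a : (forall j, 0 <= tnth a j) ->
  mu2 w a = \int[mu]_(u in cube) box_moment g 1 a u.
Proof. by move=> a0; rewrite -iterated_int_box_moment. Qed.

Lemma mu3_box_moment :
  mu3 w = \int[mu]_(u in cube) box_moment g 2 [tuple 0 | _ < d] u.
Proof.
rewrite -iterated_int_box_moment; last by move=> j; rewrite tnth_mktuple.
by congr iterated_int; apply/funext => u; rewrite -prodrXl.
Qed.

End Moments.
End BoxMoments.

(** * The empirical copula *)

Section EmpiricalCopula.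
Context (R : realType) (n d : nat) (X : 'I_n -> 'I_d -> R).
Local Notation RT := (measurableTypeR R).
Local Notation cube := (unit_cube R d).

Definition obs_corner (i : 'I_n) : d.-tuple R :=
  [tuple pseudo_obs X i j | j < d].

Definition max_corner (i l : 'I_n) : d.-tuple R :=
  [tuple Num.max (pseudo_obs X i j) (pseudo_obs X l j) | j < d].

Lemma pseudo_obs_ge0 i j : 0 <= pseudo_obs X i j.
Proof. by rewrite mulr_ge0 ?invr_ge0// sumr_ge0. Qed.

Lemma obs_corner_ge0 i j : 0 <= tnth (obs_corner i) j.
Proof. by rewrite tnth_mktuple pseudo_obs_ge0. Qed.

Lemma max_corner_ge0 i l j : 0 <= tnth (max_corner i l) j.
Proof. by rewrite tnth_mktuple le_max pseudo_obs_ge0. Qed.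

Lemma empirical_copula_indic u : cube u ->
  empirical_copula X u = n%:R^-1 * \sum_(i < n) \1_(upper_box (obs_corner i)) u.
Proof.
move=> u01; congr (_ * _); apply: eq_bigr => i _.
rewrite -prod_leq_indic//; apply: eq_bigr => j _.
by rewrite tnth_mktuple.
Qed.

Lemma measurable_empirical_copula :
  measurable_fun (cube : set (d.-tuple RT)) (empirical_copula X).
Proof.
apply: (@eq_measurable_fun _ _ (d.-tuple RT) R cube (fun u =>
    n%:R^-1 * \sum_(i < n) \1_(upper_box (obs_corner i)) u)).
  by move=> u /set_mem cu; rewrite empirical_copula_indic.
apply: measurable_funTS; apply: measurable_funM => //.
apply: measurable_sum => i; apply: measurable_indic.
exact: measurable_upper_box.
Qed.

(** The square of a sum of indicators is the double sum of their products, and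
    boxes above two corners meet in the box above the maximum of the corners;
    the box above 0 is the whole cube. *)
Lemma sqr_copula_dist_expand (g : d.-tuple R -> R) u : cube u ->
  (empirical_copula X u - prod_coord u) ^+ 2 * g u =
    n%:R^-1 ^+ 2 * (\sum_(i < n) \sum_(l < n) box_moment g 0 (max_corner i l) u)
    - 2 * n%:R^-1 * (\sum_(i < n) box_moment g 1 (obs_corner i) u)
    + box_moment g 2 [tuple 0 | _ < d] u.
Proof.
move=> cu; rewrite empirical_copula_indic// {3}/box_moment.
rewrite upper_box0 [in \1_cube u]indicE mem_set// mul1r.
have -> : \sum_(i < n) \sum_(l < n) box_moment g 0 (max_corner i l) u =
    (\sum_(i < n) \1_(upper_box (obs_corner i)) u) ^+ 2 * g u.
  rewrite expr2 big_distrlr/= mulr_suml; apply: eq_bigr => i _.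
  rewrite mulr_suml; apply: eq_bigr => l _.
  rewrite /box_moment expr0 mul1r indic_upper_boxM.
  congr (\1_(upper_box _) _ * _).
  by apply: eq_from_tnth => j; rewrite !tnth_mktuple.
by rewrite /box_moment -mulr_suml; ring.
Qed.

Lemma Rintegral_sqr_copula_dist (g : d.-tuple R -> R) :
  (forall k a, (borel_lebesgue R d).-integrable cube
     (EFin \o box_moment g k a)) ->
  let J k a := \int[borel_lebesgue R d]_(u in cube) box_moment g k a u in
  \int[borel_lebesgue R d]_(u in cube)
      ((empirical_copula X u - prod_coord u) ^+ 2 * g u) =
    n%:R^-1 ^+ 2 * (\sum_(i < n) \sum_(l < n) J 0 (max_corner i l))
    - 2 * n%:R^-1 * (\sum_(i < n) J 1 (obs_corner i))
    + J 2 [tuple 0 | _ < d].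
Proof.
move=> ig J; have mc := measurable_unit_cube R d.
under eq_Rintegral => u /set_mem cu do rewrite sqr_copula_dist_expand//.
have iZ k h : (borel_lebesgue R d).-integrable cube (EFin \o h) ->
    (borel_lebesgue R d).-integrable cube (EFin \o (fun u => k * h u)).
  by move=> ih; exact: (integrableZl mc k ih).
have iB h1 h2 : (borel_lebesgue R d).-integrable cube (EFin \o h1) ->
    (borel_lebesgue R d).-integrable cube (EFin \o h2) ->
    (borel_lebesgue R d).-integrable cube (EFin \o (fun u => h1 u - h2 u)).
  by move=> ih1 ih2; exact: (integrableB mc ih1 ih2).
have i0 i := integrable_Rsum (index_enum 'I_n) mc (fun l => ig 0 (max_corner i l)).
have i00 := integrable_Rsum (index_enum 'I_n) mc i0.
have i1 := integrable_Rsum (index_enum 'I_n) mc (fun i => ig 1 (obs_corner i)).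
rewrite RintegralD//; last by apply: iB; exact: iZ.
rewrite RintegralB//; [|exact: iZ..].
rewrite !RintegralZl// !Rintegral_sum//.
by congr (_ * _ - _ + _); apply: eq_bigr => i _; rewrite Rintegral_sum.
Qed.

End EmpiricalCopula.

Unset Implicit Arguments.
Set Strict Implicit.

Theorem proposition1 (R : realType) (d n : nat) (hd : (2 <= d)%N)
    (hn : (0 < n)%N) (X : 'I_n -> 'I_d -> R) (w : d.-tuple R -> R)
    (w_bounded : [bounded w u : R^o | u in unit_cube R d])
    (w_ge0 : forall u, unit_cube R d u -> 0 <= w u)
    (w_integrable : (lebesgue_tuple R d).-integrable (unit_cube R d) (EFin \o w)) :
  weighted_cvm X w =
    \sum_(i < n)
      (n%:R^-1 * \sum_(l < n)
          mu1 w [tuple Num.max (pseudo_obs X i j) (pseudo_obs X l j) | j < d]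
       - 2 * mu2 w [tuple pseudo_obs X i j | j < d])
    + n%:R * mu3 w.
Proof.
have [g [N [M [mN N0 mg g0M wg]]]] :=
  borel_representative w_bounded w_ge0 w_integrable.
have J1 a := mu1_box_moment mN N0 mg g0M wg (a := a).
have J2 a := mu2_box_moment mN N0 mg g0M wg (a := a).
have ig k a := integrable_box_moment mg g0M k a.
have -> : weighted_cvm X w = n%:R * \int[borel_lebesgue R d]_(u in unit_cube R d)
    ((empirical_copula X u - prod_coord u) ^+ 2 * g u).
  congr (_ * _); apply: (Rintegral_lebesgue_tuple (N := N)) => //.
  - apply: measurable_funX; apply: measurable_funB.
      exact: measurable_empirical_copula.
    by apply: measurable_funTS; exact: measurable_prod_coord.
  - by move=> u; exact: sqr_ge0.
  - by move=> u; have /andP[] := g0M u.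
rewrite (Rintegral_sqr_copula_dist X ig) -(mu3_box_moment mN N0 mg g0M wg).
under eq_bigr => i _ do under eq_bigr => l _ do
  rewrite -(J1 _ (max_corner_ge0 X i l)).
under [X in _ - _ * X]eq_bigr => i _ do rewrite -(J2 _ (obs_corner_ge0 X i)).
rewrite sumrB -!mulr_sumr /max_corner /obs_corner.
have n0 : n%:R != 0 :> R by rewrite pnatr_eq0 -lt0n.
by field.
Qed.
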